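(* Let $k\in\mathbb{Z}$ and $n,m\in\mathbb{Z}^+$ with $m\ge3$. Then \[\chi_{n,k}(C_m)=\begin{cases}2 & \text{if } \gcd(3,n)\mid k \text{ and } 2\mid m,\\ 3 & \text{if } \gcd(3,n)\mid k \text{ and } 2\nmid m,\ \text{or if } \gcd(3,n)\nmid k \text{ and } 3\mid m,\end{cases}\] and $\chi_{n,k}(C_m)$ does not exist if $\gcd(3,n)\nmid k$ and $3\nmid m$.
   Context: $C_m$ is the cycle on $m$ vertices. For a graph $G=(V,E)$, a labeling $\ell:V\to\mathbb{Z}$ is proper if adjacent vertices get distinct labels, its order is the size of its image, and it is a closed coloring with remainder $k\bmod n$ if $\sum_{w\in N[v]}\ell(w)\equiv k\pmod n$ for every $v$, where $N[v]$ is the closed neighborhood of $v$. $\chi_{n,k}(G)$ exists iff a proper closed coloring with remainder $k\bmod n$ exists, and then is the minimum order of such a coloring. *)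

(* Defs.v *)
From mathcomp Require Import all_boot all_order all_algebra.

Set Implicit Arguments.
Unset Strict Implicit.
Unset Printing Implicit Defensive.

Import GRing.Theory.
Local Open Scope ring_scope.

(* A finite simple graph is a symmetric, irreflexive adjacency relation
   [e : rel T] on a finite vertex type [T]. *)

Definition closed_nbhd (T : finType) (e : rel T) (v : T) : {set T} :=
  [set w | (w == v) || e v w].

Definition proper_labeling (T : finType) (e : rel T) (l : T -> int) : Prop :=
  forall u v : T, e u v -> l u <> l v.

Definition labeling_order (T : finType) (l : T -> int) : nat :=
  size (undup (codom l)).

Definition closed_coloring (T : finType) (e : rel T) (n : nat) (k : int)
    (l : T -> int) : Prop :=
  forall v : T, (\sum_(w in closed_nbhd e v) l w = k %[mod n%:Z])%Z.

Definition proper_closed_coloring (T : finType) (e : rel T) (n : nat) (k : int)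
    (l : T -> int) : Prop :=
  proper_labeling e l /\ closed_coloring e n k l.

(* chi_{n,k} is a partial invariant, so it is given by its domain of definition
   [chi_exists] and its graph [chi_is]. *)
Definition chi_exists (T : finType) (e : rel T) (n : nat) (k : int) : Prop :=
  exists l : T -> int, proper_closed_coloring e n k l.

Definition chi_is (T : finType) (e : rel T) (n : nat) (k : int) (c : nat) : Prop :=
  (exists l : T -> int, proper_closed_coloring e n k l /\ labeling_order l = c) /\
  (forall l : T -> int, proper_closed_coloring e n k l -> (c <= labeling_order l)%N).

(* [ordS i] is [i + 1] modulo [m]. *)
Definition cycle_graph (m : nat) : rel 'I_m :=
  fun i j => (j == ordS i) || (i == ordS j).
Arguments cycle_graph m : clear implicits.

Lemma cycle_graph_sym (m : nat) : symmetric (cycle_graph m).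
Proof. by move=> i j; rewrite /cycle_graph orbC. Qed.

Lemma cycle_graph_irr (m : nat) : (1 < m)%N -> irreflexive (cycle_graph m).
Proof.
move=> m_gt1 i; rewrite /cycle_graph orbb; apply/negbTE/eqP => /(congr1 val) /=.
have := ltn_ord i; rewrite leq_eqVlt => /predU1P[i1 | lt_i1m].
  by rewrite i1 modnn => i0; rewrite -i1 i0 in m_gt1.
by rewrite modn_small // => /eqP; rewrite ltn_eqF.
Qed.

(* Main.v *)
Require Import Defs.
From mathcomp Require Import all_boot all_order all_algebra.
From mathcomp Require Import ring zify.

(** Closed neighbourhoods in the cycle are triples of consecutive vertices.
    If [gcd(3, n)] divides [k], some [a] satisfies [3 a = k] modulo [n], and
    [a + n c] is a closed coloring for every ordinary proper coloring [c].
    Otherwise [3] divides [n] but not [k]; subtracting consecutive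
    neighbourhood sums makes the labels [3]-periodic modulo [3]. If [3] does
    not divide [m] they are then constant modulo [3] and every sum is divisible
    by [3], which is absurd; if [3] divides [m], repeating [0, n, k] works.
    For the lower bounds, a proper labeling of the cycle with fewer than three
    labels is [2]-periodic. When [m] is odd it is then constant, which is
    absurd; when [3] divides [n], the equal sums [2 a + b] and [a + 2 b] force
    [a = b] modulo [3], so that [3] divides [k]. *)

Set Implicit Arguments.
Unset Strict Implicit.
Unset Printing Implicit Defensive.

Import GRing.Theory.
Local Open Scope ring_scope.

Lemma labeling_order_ge (T : finType) (l : T -> int) (s : seq int) :
  uniq s -> {subset s <= codom l} -> (size s <= labeling_order l)%N.
Proof. by move=> us sl; apply: uniq_leq_size => // x /sl; rewrite mem_undup. Qed.

Lemma labeling_order_le (T : finType) (l : T -> int) (s : seq int) :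
  (forall v, l v \in s) -> (labeling_order l <= size s)%N.
Proof.
move=> ls; apply: uniq_leq_size; first exact: undup_uniq.
by move=> x; rewrite mem_undup => /codomP[v ->].
Qed.

Lemma chi_isI (T : finType) (e : rel T) (n : nat) (k : int) (c : nat) (l : T -> int) :
  proper_closed_coloring e n k l -> (labeling_order l <= c)%N ->
  (forall l', proper_closed_coloring e n k l' -> (c <= labeling_order l')%N) ->
  chi_is e n k c.
Proof.
move=> pl lc cmin; split=> //; exists l; split=> //.
by apply/eqP; rewrite eqn_leq lc cmin.
Qed.

Lemma eqz_modD (d a b a' b' : int) :
  (a = a' %[mod d])%Z -> (b = b' %[mod d])%Z -> (a + b = a' + b' %[mod d])%Z.
Proof. by move=> ea eb; rewrite -modzDm ea eb modzDm. Qed.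

Lemma eqz_mod_dvd_mod (d n : nat) (a b : int) :
  (d %| n)%N -> (a = b %[mod n%:Z])%Z -> (a = b %[mod d%:Z])%Z.
Proof.
move=> dn /eqP; rewrite eqz_mod_dvd => nab.
by apply/eqP; rewrite eqz_mod_dvd; apply: dvdz_trans nab.
Qed.

(** By Bezout, [gcd(3, n) = 3 u + n v]; if [k] is [q] times this, then [a = q u] satisfies
    [3 a - k = - q v n]. *)
Lemma mul3_solvable (n : nat) (k : int) :
  ((gcdn 3 n)%:Z %| k)%Z -> exists a : int, (a + a + a = k %[mod n%:Z])%Z.
Proof.
case/dvdzP=> q ->; have [u [v uv]] := Bezoutz 3 n%:Z.
exists (q * u); apply/eqP; rewrite eqz_mod_dvd; apply/dvdzP; exists (- (q * v)).
have -> : (gcdn 3 n)%:Z = u * 3 + v * n%:Z by rewrite uv.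
by ring.
Qed.

(** As 3 is prime, [gcdn 3 n] is 1 or 3, and 1 divides every [k]. *)
Lemma not_gcdn3_dvd (n : nat) (k : int) :
  ~~ ((gcdn 3 n)%:Z %| k)%Z -> (3 %| n)%N /\ ~~ (3 %| k)%Z.
Proof.
have /primeP[_ p3] : prime 3 by []; have /p3/orP[/eqP->|/eqP g3] := dvdn_gcdl 3 n.
  by rewrite dvd1z.
by rewrite g3; split=> //; rewrite -g3 dvdn_gcdr.
Qed.

Section Cycle.
Variable p : nat.
(** The successor form gives ['I_m] the ring structure of the integers modulo [m], where the
    neighbours of [v] are [v + 1] and [v - 1]. *)
Local Notation m := p.+3.
Implicit Types (v w : 'I_m) (n : nat) (k : int) (l : 'I_m -> int).

Lemma ordSE v : ordS v = v + 1.
Proof. by apply: val_inj; rewrite /= addn1. Qed.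

Lemma valS v : val (v + 1) = if val v == p.+2 then 0%N else (val v).+1.
Proof.
rewrite -ordSE /=; case: eqP => [->|]; first by rewrite modnn.
by have := ltn_ord v; rewrite ltnS leq_eqVlt => /orP[/eqP //|vm _]; rewrite modn_small.
Qed.

Lemma cycle_graphE v w : cycle_graph m v w = (w == v + 1) || (w == v - 1).
Proof. by rewrite /cycle_graph !ordSE [w == v - 1]eq_sym subr_eq. Qed.

Lemma sum_closed_nbhd_cycle l v :
  \sum_(w in closed_nbhd (cycle_graph m) v) l w = l (v - 1) + l v + l (v + 1).
Proof.
have n1 : v + 1 != v by rewrite -subr_eq0 addrAC subrr add0r.
have n2 : v - 1 != v by rewrite subr_eq eq_sym.
(* This amounts to 2 being nonzero modulo [m], which holds since [m] is at least 3. *)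
have n3 : v - 1 != v + 1.
  by rewrite subr_eq -addrA -subr_eq0 opprD addNKr oppr_eq0.
rewrite (bigD1 v) ?inE ?eqxx //= (bigD1 (v + 1)) /=; last first.
  by rewrite inE cycle_graphE eqxx n1 !orbT.
rewrite (big_pred1 (v - 1)); first by ring.
move=> w; rewrite inE cycle_graphE /=.
case: (eqVneq w (v - 1)) => [->|_]; first by rewrite n2 n3 !orbT.
by case: (eqVneq w v) => //= _; rewrite orbF; case: eqP.
Qed.

Lemma proper_cycleP l :
  proper_labeling (cycle_graph m) l <-> (forall v, l v != l (v + 1)).
Proof.
split=> [pl v|pl v w]; first by apply/eqP/pl; rewrite cycle_graphE eqxx.
rewrite cycle_graphE => /orP[]/eqP->; first exact/eqP.
by apply/nesym/eqP; rewrite -{2}[v](subrK 1).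
Qed.

(** Centring the neighbourhood at [v + 1] makes the triple start at [v]. *)
Lemma closed_coloring_cycleP n k l :
  closed_coloring (cycle_graph m) n k l <->
  (forall v, (l v + l (v + 1) + l (v + 2%:R) = k %[mod n%:Z])%Z).
Proof.
split=> cl v; last first.
  by rewrite sum_closed_nbhd_cycle -(cl (v - 1)) subrK -[v - 1 + _]addrA addKr.
by rewrite -(cl (v + 1)) sum_closed_nbhd_cycle addrK -[v + 1 + _]addrA.
Qed.

(** As [d] is invertible modulo [m], adding it [(w - v) / d] times leads from [v] to [w]. *)
Lemma shift_invariant_const (T : Type) (d : nat) (f : 'I_m -> T) :
  coprime m d -> (forall v, f (v + d%:R) = f v) -> forall v w, f v = f w.
Proof.
move=> cmd fd v w.
have fdj j : f (v + d%:R *+ j) = f v.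
  by elim: j => [|j IH]; rewrite ?mulr0n ?addr0 // mulrSr addrA fd.
have ud : (d%:R : 'I_m) \is a GRing.unit by rewrite (@unitZpE m).
rewrite -(fdj (val ((w - v) / d%:R))) -mulr_natr.
by rewrite (natr_Zp ((w - v) / d%:R)) mulrC divrK // addrC subrK.
Qed.

Lemma order_proper_ge2 l :
  proper_labeling (cycle_graph m) l -> (2 <= labeling_order l)%N.
Proof.
move=> /proper_cycleP/(_ 0) pl.
apply: (@labeling_order_ge _ l [:: l 0; l (0 + 1)]).
  by rewrite /= inE pl.
by move=> x; rewrite !inE => /orP[]/eqP->; apply: codom_f.
Qed.

(** [l (v + 1)] differs from both [l v] and [l (v + 2)], so if these two differed there would be
    three labels. *)
Lemma order_lt3_alternates l :
  proper_labeling (cycle_graph m) l -> (labeling_order l < 3)%N ->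
  forall v, l (v + 2%:R) = l v.
Proof.
move=> /proper_cycleP pl l3 v; apply/eqP; apply: contraTT l3 => nv.
rewrite -leqNgt.
apply: (@labeling_order_ge _ l [:: l v; l (v + 1); l (v + 2%:R)]).
  rewrite /= !inE negb_or pl eq_sym nv /=.
  by have := pl (v + 1); rewrite -addrA => ->.
by move=> x; rewrite !inE => /or3P[]/eqP->; apply: codom_f.
Qed.

Lemma order_odd_cycle_ge3 l :
  odd m -> proper_labeling (cycle_graph m) l -> (3 <= labeling_order l)%N.
Proof.
move=> om pl; rewrite leqNgt; apply/negP=> /(order_lt3_alternates pl) l2.
have /proper_cycleP/(_ 0)/eqP[] := pl.
by apply: (shift_invariant_const _ l2); rewrite coprimen2.
Qed.

Lemma order_closed_ge3 n k l :
  (3 %| n)%N -> ~~ (3 %| k)%Z ->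
  proper_closed_coloring (cycle_graph m) n k l -> (3 <= labeling_order l)%N.
Proof.
move=> n3 k3 [pl /closed_coloring_cycleP cl].
rewrite leqNgt; apply/negP=> /(order_lt3_alternates pl) l2.
have := cl 0; have := cl (0 + 1).
rewrite l2 -[0 + 1 + 1]addrA l2.
move=> /(@eqz_mod_dvd_mod 3 _ _ _ n3) e1 /(@eqz_mod_dvd_mod 3 _ _ _ n3) e2.
move: e1 e2 k3; set a := l 0; set b := l _; lia.
Qed.

Lemma no_closed_coloring_cycle n k :
  (3 %| n)%N -> ~~ (3 %| k)%Z -> ~~ (3 %| m)%N ->
  ~ chi_exists (cycle_graph m) n k.
Proof.
move=> n3 k3 m3 [l [_ /closed_coloring_cycleP cl]].
have {}cl v := @eqz_mod_dvd_mod 3 _ _ _ n3 (cl v).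
(* An equality of residues, so that [shift_invariant_const] applies to [fun v => (l v %% 3)%Z]. *)
have l3 v : (l (v + 3%:R) %% 3)%Z = (l v %% 3)%Z.
  have := cl (v + 1); rewrite -[v + 1 + 1]addrA -[v + 1 + 2]addrA nat1r.
  have cancel (a b c d : int) : (a + b + c = k %[mod 3%:Z])%Z ->
    (b + c + d = k %[mod 3%:Z])%Z -> (d %% 3)%Z = (a %% 3)%Z by lia.
  exact: cancel (cl v).
have lc := shift_invariant_const _ l3.
have {}lc : forall v w, (l v %% 3)%Z = (l w %% 3)%Z.
  by apply: lc; rewrite coprime_sym prime_coprime.
have := cl 0; have := lc (0 + 1) 0; have := lc (0 + 2%:R) 0.
move: k3; set a := l 0; set b := l _; set c := l _; lia.
Qed.

(** The parity of the index alternates 0 and 1. For odd [m] the last vertex, of even index [p.+2],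
    would clash with vertex 0 and takes the third color 2. *)
Lemma proper_coloring_cycle :
  exists c : 'I_m -> nat, (forall v, c v != c (v + 1)) /\
    (forall v, c v < 2 + odd m)%N.
Proof.
pose c i : nat := if odd m && (i == p.+2) then 2%N else odd i.
exists (fun v => c (val v)); split=> v; rewrite /c.
  rewrite valS; case: (eqVneq (val v) p.+2) => [->|_] /=.
    by case: (odd p).
  by case: (v.+1 == p.+2); case: (odd v); case: (odd p).
by case: ifP => [/andP[-> _] //|_]; case: (odd _); case: (odd m).
Qed.

(** Modulo [n] every label is [a], so each sum is [3 a]; since [n] is nonzero, distinct colors stay
    distinct. *)
Lemma lift_coloring_cycle n k :
  (0 < n)%N -> ((gcdn 3 n)%:Z %| k)%Z ->
  exists l, proper_closed_coloring (cycle_graph m) n k l /\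
    (labeling_order l <= 2 + odd m)%N.
Proof.
move=> n0 /mul3_solvable[a ak]; have [c [pc cb]] := proper_coloring_cycle.
exists (fun v => a + (c v)%:Z * n%:Z); split; last first.
  rewrite -[X in (_ <= X)%N](size_iota 0).
  rewrite -(size_map (fun j : nat => a + j%:Z * n%:Z)).
  apply: labeling_order_le => v.
  by apply/mapP; exists (c v); rewrite // mem_iota cb.
split.
  have nz : n%:Z != 0 by rewrite eqz_nat -lt0n.
  apply/proper_cycleP => v.
  by rewrite (inj_eq (addrI a)) (inj_eq (mulIf nz)) eqz_nat pc.
apply/closed_coloring_cycleP => v; rewrite -ak.
have cE w : (a + (c w)%:Z * n%:Z = a %[mod n%:Z])%Z by rewrite addrC modzMDl.
by apply: eqz_modD => //; apply: eqz_modD.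
Qed.

(** Any three consecutive labels are [0], [n], [k] in some order. They are distinct since [n] is
    positive and 3 divides [0] and [n] but not [k]. *)
Lemma coloring_cycle_dvd3 n k :
  (0 < n)%N -> (3 %| n)%N -> ~~ (3 %| k)%Z -> (3 %| m)%N ->
  exists l, proper_closed_coloring (cycle_graph m) n k l /\
    (labeling_order l <= 3)%N.
Proof.
move=> n0 n3 k3 m3; pose s := [:: 0; n%:Z; k].
pose l v := nth 0 s (v %% 3).
(* Wrapping around preserves indices modulo 3 because 3 divides [m]. *)
have valD v j : (val (v + j%:R)%R %% 3 = (v %% 3 + j) %% 3)%N.
  by rewrite Zp_nat /= modnDmr modn_dvdm // modnDml.
exists l; split; last first.
  by apply: (@labeling_order_le _ l s) => v; rewrite mem_nth // ltn_mod.
split.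
  apply/proper_cycleP => v; rewrite /l (valD v 1%N).
  by case: (v %% 3)%N (ltn_mod v 3) => [|[|[]]] //= _; lia.
apply/closed_coloring_cycleP => v; rewrite /l (valD v 1%N) (valD v 2).
have e : (0 + n%:Z + k = k %[mod n%:Z])%Z by rewrite add0r modzDl.
by case: (v %% 3)%N (ltn_mod v 3) => [|[|[]]] //= _; rewrite -[RHS]e; congr modz; ring.
Qed.

End Cycle.

Theorem theorem4p5 (k : int) (n m : nat) (hn : (0 < n)%N) (hm : (3 <= m)%N) :
  [/\ ((gcdn 3 n)%:Z %| k)%Z /\ (2 %| m)%N ->
        chi_is (cycle_graph m) n k 2,
      (((gcdn 3 n)%:Z %| k)%Z /\ ~~ (2 %| m)%N) \/
      (~~ ((gcdn 3 n)%:Z %| k)%Z /\ (3 %| m)%N) ->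
        chi_is (cycle_graph m) n k 3
    & ~~ ((gcdn 3 n)%:Z %| k)%Z /\ ~~ (3 %| m)%N ->
        ~ chi_exists (cycle_graph m) n k].
Proof.
case: m hm => [|[|[|p]]] // _; rewrite dvdn2 negbK; split.
- move=> [gk /negbTE em]; have [l [pl lo]] := lift_coloring_cycle p hn gk.
  rewrite em in lo; apply: (chi_isI pl lo) => l' [pl' _].
  exact: order_proper_ge2.
(* Three labels are forced by odd length in the first case and by the neighbourhood sums in the
   second. *)
- move=> [[gk om]|[/not_gcdn3_dvd[n3 k3] m3]].
    have [l [pl lo]] := lift_coloring_cycle p hn gk.
    rewrite om in lo; apply: (chi_isI pl lo) => l' [pl' _].
    exact: order_odd_cycle_ge3.
  have [l [pl lo]] := coloring_cycle_dvd3 hn n3 k3 m3.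
  by apply: (chi_isI pl lo) => l'; apply: order_closed_ge3.
- by move=> [/not_gcdn3_dvd[n3 k3] m3]; apply: no_closed_coloring_cycle.
Qed.
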